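(* Let $p,m\in\mathbb{N}$, let $F:\mathbb{R}^p\to\mathbb{R}^m$ be continuously differentiable, and for each $x\in\mathbb{R}^p$ let $\mathcal{D}_x$ be a distribution over pairs of matrices $(\mathbf{S},\mathbf{W})$ with $\mathbf{S}\in\mathbb{R}^{m\times\tau}$, $\mathbf{W}\in\mathbb{R}^{p\times p}$. Assume: (1) (proper finite distribution) for every $x\in\mathbb{R}^p$ there exist $r\in\mathbb{N}$, $\pi_1,\dots,\pi_r>0$ with $\sum_{i=1}^r\pi_i=1$, and matrices $\{(\mathbf{S}_i(x),\mathbf{W}_i(x))\}_{i=1}^r$ such that $\mathbb{P}_{(\mathbf{S},\mathbf{W})\sim\mathcal{D}_x}[(\mathbf{S},\mathbf{W})=(\mathbf{S}_i(x),\mathbf{W}_i(x))]=\pi_i$ for $i=1,\dots,r$; (2) for every $x\in\mathbb{R}^p$, the matrices $\nabla F(x)^\top\nabla F(x)$ and $\mathbb{E}_{\mathcal{D}_x}[\mathbf{S}\mathbf{S}^\top]$ are invertible, and every $\mathbf{W}\sim\mathcal{D}_x$ is symmetric positive definite. Let $\gamma>0$ and let $(x^k)_{k\in\mathbb{N}}$ be generated by the SNRVM algorithm with step size $\gamma$ (see context), with $\hat f_k(x)=\frac12\|F(x)\|^2_{(\nabla F(x^k)^\top\mathbf{W}_k^{-1}\nabla F(x^k))^\dagger}$. Assume moreover: (3) there exists $L>0$ such that, for every $k\in\mathbb{N}$ and every $x\in\mathbb{R}^p$, $$\hat f_{k+1}(x)\le \hat f_k(x^k)+\langle\nabla\hat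 f_k(x^k),x-x^k\rangle+\tfrac{L}{2}\|x-x^k\|^2_{\mathbf{W}_k};$$ and that $\gamma=1/L$. Define, with $(\mathbf{S},\mathbf{W})\sim\mathcal{D}_x$, $$\mathbf{H}(x)=\mathbb{E}\left[\mathbf{S}\left(\mathbf{S}^\top\nabla F(x)^\top\mathbf{W}^{-1}\nabla F(x)\mathbf{S}\right)^\dagger\mathbf{S}^\top\right],\qquad \rho(x)=\min_{i=1,\dots,r}\lambda^+_{\min}\left(\mathbf{M}_i\mathbf{H}(x)\mathbf{M}_i^\top\right),\quad \mathbf{M}_i=\mathbf{W}_i(x)^{-1/2}\nabla F(x).$$ Assume that there exists $\rho>0$ such that $\inf_{k\in\mathbb{N}}\rho(x^k)\ge\rho$ almost surely. Then for every $k\in\mathbb{N}$, $$\mathbb{E}[\hat f_k(x^k)]\le(1-\rho\gamma)^k\,\mathbb{E}[\hat f_0(x^0)].$$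
   Context: Conventions: $\nabla F(x)\in\mathbb{R}^{p\times m}$ is the transpose of the usual Jacobian (its $i$-th column is the gradient of the $i$-th component of $F$). $^\dagger$ is the Moore–Penrose pseudoinverse. For a symmetric positive semidefinite matrix $\mathbf{M}$, $\|v\|_{\mathbf{M}}^2=\langle \mathbf{M}v,v\rangle$. $\lambda_{\min}^+$ denotes the smallest positive eigenvalue. SNRVM (Sketched Newton Raphson with Variable Metric) with step size $\gamma>0$: from a given deterministic $x^0\in\mathbb{R}^p$, at each iteration $k$, conditionally on the past, sample $(\mathbf{S}_k,\mathbf{W}_k)\sim\mathcal{D}_{x^k}$ and set $$x^{k+1}=x^k-\gamma\mathbf{W}_k^{-1}\nabla F(x^k)\mathbf{S}_k\left(\mathbf{S}_k^\top\nabla F(x^k)^\top\mathbf{W}_k^{-1}\nabla F(x^k)\mathbf{S}_k\right)^\dagger\mathbf{S}_k^\top F(x^k).$$ The function $\hat f_k$ is random, through $x^k$ and $\mathbf{W}_k$; in its definition $x^k$ and $\mathbf{W}_k$ are held fixed, so $\nabla\hat f_k(x)=\nabla F(x)(\nabla F(x^k)^\top\mathbf{W}_k^{-1}\nabla F(x^k))^\dagger F(x)$. Assumption (3) is required for every realization of the random choices of the run. *)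

(* Defs.v *)
From mathcomp Require Import all_boot all_order all_algebra.
From mathcomp Require Import all_classical all_reals all_analysis.

Set Implicit Arguments.
Unset Strict Implicit.
Unset Printing Implicit Defensive.

Import Order.TTheory GRing.Theory Num.Theory.
Import numFieldNormedType.Exports.

Local Open Scope classical_set_scope.
Local Open Scope ring_scope.

Section LinearAlgebra.
Context {R : realType}.

Definition dotv n (u v : 'cV[R]_n) : R := (u^T *m v) 0 0.

Definition sqnorm n (M : 'M[R]_n) (v : 'cV[R]_n) : R := dotv (M *m v) v.

Definition sym_psd n (M : 'M[R]_n) : Prop :=
  M^T = M /\ forall v : 'cV[R]_n, 0 <= sqnorm M v.

Definition sym_pd n (M : 'M[R]_n) : Prop :=
  M^T = M /\ forall v : 'cV[R]_n, v != 0 -> 0 < sqnorm M v.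

Definition penrose m n (A : 'M[R]_(m, n)) (B : 'M[R]_(n, m)) : Prop :=
  [/\ A *m B *m A = A, B *m A *m B = B,
      (A *m B)^T = A *m B & (B *m A)^T = B *m A].

(* Every real matrix has exactly one Penrose inverse, so the default value 0
   of xget is never used. *)
Definition mpinv m n (A : 'M[R]_(m, n)) : 'M[R]_(n, m) :=
  xget 0 [set B | penrose A B].

(* Symmetric positive semidefinite square root, which exists and is unique
   when A itself is symmetric positive semidefinite. *)
Definition sqrtmx n (A : 'M[R]_n) : 'M[R]_n :=
  xget 0 [set B | sym_psd B /\ B *m B = A].

(* The set of positive eigenvalues is finite: the infimum is a minimum as soon
   as there is one, and it is 0 (inf set0) when there is none. *)
Definition lambda_min_pos n (A : 'M[R]_n) : R :=
  inf [set a | 0 < a /\ eigenvalue A a].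

End LinearAlgebra.

Section Differential.
Context {R : realType}.

Definition grad p (f : 'cV[R]_p -> R) (x : 'cV[R]_p) : 'cV[R]_p :=
  \col_i 'D_(delta_mx i 0) f x.

(* Transposed Jacobian: column j is the gradient of the j-th component. *)
Definition nabla p m (F : 'cV[R]_p -> 'cV[R]_m) (x : 'cV[R]_p)
    : 'M[R]_(p, m) :=
  \matrix_(i, j) grad (fun y => F y j 0) x i 0.

Definition C1 p m (F : 'cV[R]_p -> 'cV[R]_m) : Prop :=
  (forall x, differentiable F x) /\ continuous (nabla F).

End Differential.

(* Pairs (S, W) with the Borel sigma-algebra of the product topology. *)
Definition mxpair (R : realType) (m tau p : nat) :=
  g_sigma_algebraType (@open ('M[R]_(m, tau) * 'M[R]_p)%type).

Definition Emx (R : realType) d (T : measurableType d) (P : probability T R)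
    m n (X : T -> 'M[R]_(m, n)) : 'M[R]_(m, n) :=
  \matrix_(i, j) \int[P]_t X t i j.

Section SNRVM.
Context {R : realType} {p m tau : nat}.
Variable F : 'cV[R]_p -> 'cV[R]_m.

Definition sketched_pinv (x : 'cV[R]_p) (S : 'M[R]_(m, tau)) (W : 'M[R]_p)
    : 'M[R]_tau :=
  mpinv (S^T *m (nabla F x)^T *m invmx W *m nabla F x *m S).

Definition snrvm_next (gamma : R) (x : 'cV[R]_p) (S : 'M[R]_(m, tau))
    (W : 'M[R]_p) : 'cV[R]_p :=
  x - gamma *: (invmx W *m nabla F x *m S *m sketched_pinv x S W
                *m S^T *m F x).

(* The function $\hat f_k$, for xk and Wk held fixed. *)
Definition fhat (xk : 'cV[R]_p) (Wk : 'M[R]_p) (y : 'cV[R]_p) : R :=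
  2^-1 * sqnorm (mpinv ((nabla F xk)^T *m invmx Wk *m nabla F xk)) (F y).

Variable D : 'cV[R]_p -> probability (mxpair R m tau p) R.

Definition Hmx (x : 'cV[R]_p) : 'M[R]_m :=
  Emx (D x) (fun sw => sw.1 *m sketched_pinv x sw.1 sw.2 *m sw.1^T).

(* The W i are the second components of the r atoms of D x; the infimum is
   over a finite family, nonempty when r > 0. *)
Definition rho_at (x : 'cV[R]_p) (r : nat) (W : 'I_r -> 'M[R]_p) : R :=
  inf (range (fun i : 'I_r =>
    let M := invmx (sqrtmx (W i)) *m nabla F x in
    lambda_min_pos (M *m Hmx x *m M^T))).

Context {d : measure_display} {Omega : measurableType d}.
Variable P : probability Omega R.

(* Sigma-algebra generated by the pairs drawn before iteration k. *)
Definition past (SW : nat -> Omega -> mxpair R m tau p) (k : nat)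
    : set_system Omega :=
  <<s \bigcup_(j in [set j | (j < k)%N])
        preimage_set_system setT (SW j) measurable >>.

(* snrvm_law says that D (x k) is the conditional distribution of SW k given
   the past. *)
Record snrvm (gamma : R) (x0 : 'cV[R]_p) (x : nat -> Omega -> 'cV[R]_p)
    (SW : nat -> Omega -> mxpair R m tau p) : Prop := {
  snrvm_measurable : forall k, measurable_fun setT (SW k);
  snrvm_init : forall w, x 0%N w = x0;
  snrvm_step : forall k w,
    x k.+1 w = snrvm_next gamma (x k w) (SW k w).1 (SW k w).2;
  snrvm_law : forall k A B, past SW k A -> measurable B ->
    P (A `&` SW k @^-1` B) = (\int[P]_(w in A) D (x k w) B)%E
}.

End SNRVM.

(* Main.v *)
(* Write phi(x, W) for fhat at its own base point, A = J^T W^-1 J with J = nabla F(x),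
   and Z = S (S^T A S)^+ S^T.  The step minimizes the quadratic upper bound (3)
   along its direction, and A^+ = A^-1 together with Z A Z = Z turns (3) into
   phi(x^{k+1}) <= phi(x^k) - gamma/2 <Z F, F>.  Averaging over (S, W) replaces Z
   by H.  With M = W^{-1/2} J one has F = M^T u for u = M A^-1 F, and u lies in the
   range of M H M^T because H is invertible; hence
   <H F, F> = <M H M^T u, u> >= rho |u|^2 = 2 rho phi.

   Since each D_x is finitely supported and x^0 is deterministic, x^k takes almost
   surely finitely many values.  So the expectations are finite sums over the tree
   of draws. *)

Require Import Defs.
From mathcomp Require Import all_boot all_order all_algebra.
From mathcomp Require Import complex.
From mathcomp Require Import all_classical all_reals all_analysis.
From mathcomp Require Import measurable_realfun.
From mathcomp Require Import ring lra.

Set Implicit Arguments.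
Unset Strict Implicit.
Unset Printing Implicit Defensive.

Import Order.TTheory GRing.Theory Num.Theory.
Import numFieldNormedType.Exports.
Local Open Scope classical_set_scope.
Local Open Scope ring_scope.

(** * Pseudoinverse and functional calculus *)

Section LinearAlgebra.
Context {R : realType}.

Lemma dotvE n (u v : 'cV[R]_n) : dotv u v = \sum_i u i 0 * v i 0.
Proof. by rewrite /dotv mxE; apply: eq_bigr => i _; rewrite mxE. Qed.

Lemma dotvC n (u v : 'cV[R]_n) : dotv u v = dotv v u.
Proof. by rewrite !dotvE; apply: eq_bigr => i _; rewrite mulrC. Qed.

Lemma dotv_mulmxl m n (A : 'M[R]_(m, n)) u v : dotv (A *m u) v = dotv u (A^T *m v).
Proof. by rewrite /dotv trmx_mul -mulmxA. Qed.

Lemma dotvDr n (u v w : 'cV[R]_n) : dotv u (v + w) = dotv u v + dotv u w.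
Proof. by rewrite /dotv mulmxDr mxE. Qed.

Lemma dotvZr n a (u v : 'cV[R]_n) : dotv u (a *: v) = a * dotv u v.
Proof. by rewrite /dotv -scalemxAr mxE. Qed.

Lemma dotvZl n a (u v : 'cV[R]_n) : dotv (a *: u) v = a * dotv u v.
Proof. by rewrite dotvC dotvZr dotvC. Qed.

Lemma dotvNr n (u v : 'cV[R]_n) : dotv u (- v) = - dotv u v.
Proof. by rewrite -scaleN1r dotvZr mulN1r. Qed.

Lemma dotvv_ge0 n (u : 'cV[R]_n) : 0 <= dotv u u.
Proof. by rewrite dotvE sumr_ge0// => i _; rewrite -expr2 sqr_ge0. Qed.

Lemma dotvv_eq0 n (u : 'cV[R]_n) : dotv u u = 0 -> u = 0.
Proof.
rewrite dotvE => /eqP; rewrite psumr_eq0 => [/allP u0|i _]; last first.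
  by rewrite -expr2 sqr_ge0.
apply/colP => i; rewrite mxE; apply/eqP.
by have := u0 i (mem_index_enum i); rewrite mulf_eq0 orbb.
Qed.

Lemma sqnorm_ctrmx m n (A : 'M[R]_(m, n)) (u : 'cV[R]_n) :
  sqnorm (A^T *m A) u = dotv (A *m u) (A *m u).
Proof. by rewrite /sqnorm -mulmxA dotv_mulmxl trmxK. Qed.

Lemma inj_unitmx n (A : 'M[R]_n) :
  (forall v : 'cV[R]_n, A *m v = 0 -> v = 0) -> A \in unitmx.
Proof.
move=> A0; rewrite -unitmx_tr -row_free_unit -kermx_eq0; apply/eqP/row_matrixP => i.
apply: trmx_inj; rewrite row0 trmx0; apply: A0.
by apply: trmx_inj; rewrite trmx_mul trmxK trmx0 -row_mul mulmx_ker row0.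
Qed.

Lemma gram_unitmx m n (A : 'M[R]_(m, n)) :
  row_free A^T -> A^T *m A \in unitmx.
Proof.
move=> fA; apply: inj_unitmx => v AAv.
have /dotvv_eq0 Av : dotv (A *m v) (A *m v) = 0.
  by rewrite -sqnorm_ctrmx /sqnorm AAv dotvC dotvE big1// => i _; rewrite mxE mulr0.
apply: trmx_inj; rewrite trmx0; apply: (row_free_inj fA).
by rewrite -trmx_mul Av mul0mx trmx0.
Qed.

(** Full-rank factorization [A = C *m S]: the Gram matrices [C^T *m C] and [S *m S^T] are
    invertible, and a right inverse of [S] times a left inverse of [C] satisfies the four
    identities. *)
Lemma penrose_exists m n (A : 'M[R]_(m, n)) : exists B, penrose A B.
Proof.
have [k [C [S [CS fC fS]]]] : exists k (C : 'M[R]_(m, k)) (S : 'M[R]_(k, n)),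
    [/\ C *m S = A, row_free C^T & row_free S].
  exists (\rank A), (col_base A), (row_base A); split; first exact: mulmx_base.
    by rewrite /row_free mxrank_tr; exact: col_base_full.
  exact: row_base_free.
have uC : C^T *m C \in unitmx by exact: gram_unitmx.
have uS : S *m S^T \in unitmx by have := @gram_unitmx _ _ S^T; rewrite trmxK; apply.
have symC : (invmx (C^T *m C))^T = invmx (C^T *m C).
  by rewrite trmx_inv trmx_mul trmxK.
have symS : (invmx (S *m S^T))^T = invmx (S *m S^T).
  by rewrite trmx_inv trmx_mul trmxK.
pose B := S^T *m invmx (S *m S^T) *m (invmx (C^T *m C) *m C^T).
have AB : A *m B = C *m (invmx (C^T *m C) *m C^T).
  by rewrite -CS /B -!mulmxA; congr (_ *m _); rewrite 3!mulmxA mulmxV// mul1mx.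
have BA : B *m A = S^T *m invmx (S *m S^T) *m S.
  rewrite -[in LHS]CS /B -!mulmxA; congr (_ *m (_ *m _)).
  by rewrite (mulmxA C^T) mulKmx.
exists B; split.
- rewrite AB -[X in _ *m X = _]CS -!mulmxA (mulmxA C^T) mulKmx//.
- rewrite BA /B -!mulmxA; congr (_ *m (_ *m _)).
  by rewrite (mulmxA S) mulKVmx.
- by rewrite AB !trmx_mul trmxK symC mulmxA.
- by rewrite BA !trmx_mul trmxK symS mulmxA.
Qed.

(** [A *m B] and [A *m C] are symmetric idempotents with the range of [A], hence the same orthogonal
    projector; likewise on the other side. Then [B = B *m A *m B = C *m A *m C = C]. *)
Lemma penrose_unique m n (A : 'M[R]_(m, n)) B C :
  penrose A B -> penrose A C -> B = C.
Proof.
move=> [ABA BAB sAB sBA] [ACA CAC sAC sCA].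
have eqAB : A *m B = A *m C.
  transitivity ((A *m B *m (A *m C))^T); last by rewrite mulmxA ABA.
  by rewrite trmx_mul sAB sAC mulmxA ACA.
have eqBA : B *m A = C *m A.
  transitivity ((C *m A *m (B *m A))^T); last by rewrite -mulmxA (mulmxA A) ABA.
  by rewrite trmx_mul sBA sCA -mulmxA (mulmxA A) ACA.
by rewrite -BAB -mulmxA eqAB mulmxA eqBA CAC.
Qed.

Lemma mpinvP m n (A : 'M[R]_(m, n)) : penrose A (mpinv A).
Proof.
have [B AB] := penrose_exists A.
by rewrite /mpinv; apply: (@xgetPex _ 0 [set B | penrose A B]); exists B.
Qed.

Lemma mpinv_unit n (A : 'M[R]_n) : A \in unitmx -> mpinv A = invmx A.
Proof.
move=> uA; have [+ _ _ _] := mpinvP A.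
move=> /(congr1 (fun X => invmx A *m X *m invmx A)).
by rewrite mulVmx// mul1mx -!mulmxA mulKmx// mulmxV// mulmx1.
Qed.

Lemma mpinv_sym n (A : 'M[R]_n) : A^T = A -> (mpinv A)^T = mpinv A.
Proof.
move=> sA; have [ABA BAB sAB sBA] := mpinvP A.
apply: (@penrose_unique _ _ A); last exact: mpinvP.
split.
- by rewrite -[RHS]sA -[in RHS]ABA !trmx_mul sA mulmxA.
- by rewrite -[RHS](congr1 trmx BAB) !trmx_mul sA mulmxA.
- by rewrite trmx_mul trmxK sA -sBA trmx_mul sA.
- by rewrite trmx_mul trmxK sA -sAB trmx_mul sA.
Qed.

Lemma sym_pd_unit n (A : 'M[R]_n) : sym_pd A -> A \in unitmx.
Proof.
move=> [_ Agt0]; apply: inj_unitmx => v Av0.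
apply/eqP/negPn/negP => /Agt0.
by rewrite /sqnorm Av0 dotvC dotvE big1 ?ltxx// => i _; rewrite mxE mulr0.
Qed.

Lemma sym_pd_inv n (A : 'M[R]_n) : sym_pd A -> sym_pd (invmx A).
Proof.
move=> pA; have uA := sym_pd_unit pA; case: pA => sA Agt0.
split=> [|v v0]; first by rewrite trmx_inv sA.
rewrite /sqnorm dotvC -{1}(mulKVmx uA v).
apply: Agt0; apply: contra v0 => /eqP v0.
by rewrite -(mulKVmx uA v) v0 mulmx0.
Qed.

Lemma sym_pd_conj m n (A : 'M[R]_m) (B : 'M[R]_(m, n)) :
  sym_pd A -> (forall v : 'cV[R]_n, B *m v = 0 -> v = 0) ->
  sym_pd (B^T *m A *m B).
Proof.
move=> [sA Agt0] Binj; split=> [|v v0].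
  by rewrite !trmx_mul trmxK sA mulmxA.
rewrite /sqnorm -!mulmxA dotv_mulmxl trmxK; apply: Agt0.
by apply: contra v0 => /eqP/Binj ->.
Qed.

(** * Spectral calculus of real symmetric matrices *)

Local Notation toC := (real_complex R).

(* Over [R[i]] the spectral theorem diagonalizes [A] with real eigenvalues, and
   real similarity descends to [R].  The similarity [Q] need not be orthogonal,
   but [A^T = A] says that [Q *m Q^T] commutes with [diag_mx d], hence with
   [diag_mx (map_mx f d)] for any [f]. *)
Lemma sym_calculus n (A : 'M[R]_n) : A^T = A ->
  exists (Q : 'M[R]_n) (d : 'rV[R]_n),
  [/\ Q \in unitmx, A = invmx Q *m diag_mx d *m Q,
      forall i, eigenvalue A (d 0 i) &
      forall f : R -> R,
        (invmx Q *m diag_mx (map_mx f d) *m Q)^T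
          = invmx Q *m diag_mx (map_mx f d) *m Q].
Proof.
move=> sA.
pose AC := map_mx toC A.
have realAC : AC \is a mxOver Num.real.
  by apply/mxOverP => i j; rewrite mxE; apply/complex_realP; exists (A i j).
have hermAC : AC \is hermsymmx.
  apply: realsym_hermsym => //; apply/is_hermitianmxP.
  by rewrite expr0 scale1r map_mx_id// map_trmx sA.
have /orthomx_spectralP := hermitian_normalmx hermAC.
set P := spectralmx AC; set D := spectral_diag AC => AE.
have realD : D \is a mxOver Num.real by exact: hermitian_spectral_diag_real.
have uP : P \in unitmx by exact: spectral_unit.
have [d Dd] : exists d : 'rV[R]_n, D = map_mx toC d.
  exists (map_mx (@complex.Re R) D); apply/rowP => j; rewrite !mxE.
  by rewrite RRe_real//; exact: (mxOverP realD).
have realdD : diag_mx D \is a mxOver Num.real.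
  apply/mxOverP => i j; rewrite mxE.
  by case: eqP => _; rewrite ?mulr1n ?mulr0n//; exact: (mxOverP realD).
have simAD : similar_in unitmx AC (diag_mx D).
  by exists P => //; apply/similarP => //; rewrite AE -!mulmxA mulKVmx.
have [PR] := real_similar simAD realAC realdD.
rewrite inE => /andP[realPR uPR] /(similarP uPR) PRA.
have [Q PRQ] : exists Q : 'M[R]_n, PR = map_mx toC Q.
  exists (map_mx (@complex.Re R) PR); apply/matrixP => i j; rewrite !mxE.
  by rewrite RRe_real//; exact: (mxOverP realPR).
have uQ : Q \in unitmx by rewrite -(map_unitmx toC) -PRQ.
have QA : Q *m A = diag_mx d *m Q.
  apply: (@map_mx_inj _ _ toC); rewrite !map_mxM map_diag_mx -PRQ -Dd.
  exact: PRA.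
have AQ : A = invmx Q *m diag_mx d *m Q by rewrite -mulmxA -QA mulKmx.
exists Q, d; split => // [i|f].
  (* Eigenvectors are row vectors here: [Q *m A = diag_mx d *m Q] makes each row of [Q] one, nonzero
     because [Q] is invertible. *)
  apply/eigenvalueP; exists (row i Q).
    by rewrite -row_mul QA; apply/rowP => j; rewrite mul_diag_mx !mxE.
  apply/negP => /eqP Qi0.
  have := congr1 (row i) (mulmxV uQ); rewrite row_mul Qi0 mul0mx.
  move=> /rowP/(_ i); rewrite !mxE eqxx => /esym/eqP.
  by rewrite oner_eq0.
have comm : diag_mx d *m (Q *m Q^T) = (Q *m Q^T) *m diag_mx d.
  rewrite mulmxA -QA -(mulmxA Q) -mulmxA; congr (_ *m _).
  have := congr1 trmx QA; rewrite !trmx_mul sA tr_diag_mx => ->//.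
(* Entry [(i, j)] of [Q *m Q^T] can be nonzero only if [d 0 i = d 0 j], and then [f] takes the same
   value at both. *)
have commf : diag_mx (map_mx f d) *m (Q *m Q^T) = (Q *m Q^T) *m diag_mx (map_mx f d).
  apply/matrixP => i j; move/matrixP/(_ i j): comm.
  rewrite !mul_diag_mx !mul_mx_diag !mxE => /eqP.
  rewrite [X in _ == X]mulrC -subr_eq0 -mulrBl mulf_eq0 subr_eq0 => /orP[] /eqP ->.
    by rewrite mulrC.
  by rewrite mul0r mulr0.
rewrite !trmx_mul tr_diag_mx trmx_inv.
have uQT : Q^T \in unitmx by rewrite unitmx_tr.
apply: (can_inj (mulKmx uQ)); apply: (can_inj (mulmxK uQT)).
rewrite -!mulmxA mulVmx// mulmx1 [in RHS]mulKVmx//.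
by rewrite mulmxA -commf.
Qed.

Lemma eigenvalue_psd n (A : 'M[R]_n) a : sym_psd A -> eigenvalue A a -> 0 <= a.
Proof.
move=> [sA A0] /eigenvalueP[v vA v0].
have : 0 <= sqnorm A v^T by [].
rewrite /sqnorm -{1}sA -trmx_mul vA linearZ/= dotvZl.
rewrite pmulr_lge0// lt_neqAle dotvv_ge0 andbT eq_sym.
by apply: contra v0 => /eqP/dotvv_eq0/(congr1 trmx)/eqP; rewrite trmxK trmx0.
Qed.

Lemma sqrtmxP n (A : 'M[R]_n) : sym_psd A ->
  sym_psd (sqrtmx A) /\ sqrtmx A *m sqrtmx A = A.
Proof.
move=> pA; rewrite /sqrtmx.
apply: (@xgetPex _ 0 [set B | sym_psd B /\ B *m B = A]).
have [Q [d [uQ AE eA symf]]] := sym_calculus pA.1.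
have calcM f g : invmx Q *m diag_mx (map_mx f d) *m Q
    *m (invmx Q *m diag_mx (map_mx g d) *m Q)
    = invmx Q *m diag_mx (map_mx (fun t => f t * g t) d) *m Q.
  rewrite -!mulmxA mulKVmx// !mulmxA -(mulmxA (invmx Q)) mulmx_diag.
  by congr (_ *m diag_mx _ *m _); apply/rowP => j; rewrite !mxE.
exists (invmx Q *m diag_mx (map_mx (@Num.sqrt R) d) *m Q); split; last first.
  rewrite calcM AE; congr (_ *m diag_mx _ *m _); apply/rowP => j.
  by rewrite !mxE -expr2 sqr_sqrtr// (@eigenvalue_psd _ A).
split; first exact: symf.
(* Positivity of the root: it is the Gram matrix of the fourth root of [A], which [g] defines. *)
move=> v; pose g := fun t : R => Num.sqrt (Num.sqrt t).
have -> : invmx Q *m diag_mx (map_mx (@Num.sqrt R) d) *m Q =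
    (invmx Q *m diag_mx (map_mx g d) *m Q)^T *m (invmx Q *m diag_mx (map_mx g d) *m Q).
  rewrite symf calcM; congr (_ *m diag_mx _ *m _); apply/rowP => j.
  by rewrite !mxE -expr2 sqr_sqrtr// sqrtr_ge0.
by rewrite sqnorm_ctrmx dotvv_ge0.
Qed.

(** The empty set is covered by the convention that its infimum is 0, so [lambda_min_pos] is
    nonnegative even without positive eigenvalues. *)
Lemma inf_ge0 (E : set R) : lbound E 0 -> 0 <= inf E.
Proof.
have [->|/set0P E0 lbE] := eqVneq E set0; first by rewrite inf0.
exact: lb_le_inf.
Qed.

Lemma lambda_min_pos_ge0 n (A : 'M[R]_n) : 0 <= lambda_min_pos A.
Proof. by apply: inf_ge0 => a [/ltW]. Qed.

Lemma lambda_min_pos_le n (A : 'M[R]_n) a :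
  0 < a -> eigenvalue A a -> lambda_min_pos A <= a.
Proof. by move=> a0 Aa; apply: ge_inf => //; exists 0 => b [/ltW]. Qed.

(* For [g t = sqrt (t ^ 2 * (t - lambda))], the difference of the two sides is the
   squared norm of [g(K) w]; every eigenvalue [t] of [K] is 0 or at least [lambda]. *)
Lemma lambda_min_pos_range n (K : 'M[R]_n) (w : 'cV[R]_n) : sym_psd K ->
  lambda_min_pos K * dotv (K *m w) (K *m w) <= sqnorm K (K *m w).
Proof.
move=> pK; have [Q [d [uQ KE eK symf]]] := sym_calculus pK.1.
set l := lambda_min_pos K.
pose g (t : R) : R := Num.sqrt (t ^+ 2 * (t - l)).
pose G := invmx Q *m diag_mx (map_mx g d) *m Q.
have GG : G *m G = K *m K *m K - l *: (K *m K).
  have d2 : diag_mx (map_mx g d) *m diag_mx (map_mx g d) =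
      diag_mx d *m diag_mx d *m diag_mx d - l *: (diag_mx d *m diag_mx d).
    rewrite !mulmx_diag -linearZ -linearB; congr diag_mx.
    apply/rowP => j; rewrite !mxE -expr2 sqr_sqrtr; first by ring.
    have := eigenvalue_psd pK (eK j); rewrite le_eqVlt => /predU1P[<-|dj0].
      by rewrite expr0n mul0r.
    by rewrite mulr_ge0 ?sqr_ge0// subr_ge0 lambda_min_pos_le.
  rewrite /G -!mulmxA mulKVmx// (mulmxA (diag_mx _)) d2.
  rewrite KE -!mulmxA !mulKVmx// mulmxBl mulmxBr -scalemxAl -scalemxAr.
  by rewrite -!mulmxA.
have symG : G^T = G := symf g.
rewrite -subr_ge0; clearbody G.
suff -> : sqnorm K (K *m w) - l * dotv (K *m w) (K *m w) = dotv (G *m w) (G *m w).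
  exact: dotvv_ge0.
rewrite /sqnorm !dotv_mulmxl pK.1 symG !mulmxA GG mulmxBl -scalemxAl.
by rewrite dotvDr dotvNr dotvZr.
Qed.

End LinearAlgebra.

(** * The sketched step *)

Section SketchAlgebra.
Context {R : realType}.

Lemma mpinv_psd n (A : 'M[R]_n) : sym_psd A -> sym_psd (mpinv A).
Proof.
move=> [sA A0]; split=> [|v]; first exact: mpinv_sym.
have [_ BAB _ _] := mpinvP A.
rewrite -BAB /sqnorm -!mulmxA dotv_mulmxl mpinv_sym//; exact: A0.
Qed.

Lemma sym_pd_psd n (A : 'M[R]_n) : sym_pd A -> sym_psd A.
Proof.
move=> [sA A0]; split=> // v; have [->|/A0/ltW//] := eqVneq v 0.
by rewrite /sqnorm mulmx0 dotvE big1// => i _; rewrite mxE mulr0.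
Qed.

Lemma sym_psd_conj m n (A : 'M[R]_m) (B : 'M[R]_(m, n)) :
  sym_psd A -> sym_psd (B^T *m A *m B).
Proof.
move=> [sA A0]; split=> [|v]; first by rewrite !trmx_mul trmxK sA mulmxA.
by rewrite /sqnorm -!mulmxA dotv_mulmxl trmxK; exact: A0.
Qed.

Lemma sqnorm_conj m n (A : 'M[R]_m) (B : 'M[R]_(m, n)) v :
  sqnorm (B^T *m A *m B) v = sqnorm A (B *m v).
Proof. by rewrite /sqnorm -!mulmxA dotv_mulmxl trmxK. Qed.

Lemma sym_pd_eq0 n (A : 'M[R]_n) v : sym_pd A -> sqnorm A v = 0 -> v = 0.
Proof.
by move=> [_ A0] Av; apply/eqP/negPn/negP => /A0; rewrite Av ltxx.
Qed.

(** Used to show that the kernel of the averaged sketch matrix lies in the kernel of the mean of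
    [S *m S^T]. *)
Lemma sketch_ker m tau (A : 'M[R]_m) (S : 'M[R]_(m, tau)) (v : 'cV[R]_m) :
  sym_pd A -> sqnorm (S *m mpinv (S^T *m A *m S) *m S^T) v = 0 ->
  S *m S^T *m v = 0.
Proof.
move=> pA; set A' := S^T *m A *m S; set B := mpinv A'.
have psA' : sym_psd A' by apply: sym_psd_conj; exact: sym_pd_psd.
have [ABA BAB sAB sBA] := mpinvP A'; rewrite -/B in ABA BAB sAB sBA.
have sB : B^T = B by exact: mpinv_sym psA'.1.
(* Since [B = B *m A' *m B], the hypothesis says that [S *m B *m S^T *m v] has zero [A]-norm. *)
rewrite -{1}(trmxK S) sqnorm_conj -BAB -{1}sB sqnorm_conj sqnorm_conj.
move=> /(sym_pd_eq0 pA) SBz.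
have Bz : B *m (S^T *m v) = 0.
  by rewrite -BAB -!mulmxA SBz !mulmx0.
rewrite -mulmxA; apply: (sym_pd_eq0 pA).
rewrite -sqnorm_conj -/A'.
(* A symmetric matrix commutes with its pseudoinverse, so the kernel of [B] is contained in that of
   [A']. *)
have comm : A' *m B = B *m A' by rewrite -sAB trmx_mul sB psA'.1.
have A'z : A' *m (S^T *m v) = 0.
  by rewrite -ABA -(mulmxA A') -comm -!mulmxA Bz !mulmx0.
by rewrite /sqnorm A'z dotvE big1// => i _; rewrite mxE mul0r.
Qed.

Section Descent.
Variables (p m : nat) (J : 'M[R]_(p, m)) (W : 'M[R]_p).
Hypotheses (uJ : J^T *m J \in unitmx) (pW : sym_pd W).
Let A := J^T *m invmx W *m J.

Lemma metric_pd : sym_pd A.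
Proof.
apply: sym_pd_conj; first exact: sym_pd_inv.
by move=> v Jv; rewrite -(mulKmx uJ v) -mulmxA Jv !mulmx0.
Qed.

(** With [q = B S^T f], the step is [y = - gamma W^-1 J S q]. The linear term equals
    [- gamma <q, S^T f>] and the quadratic one [L / 2 * gamma ^ 2 * <q, S^T f>]; [gamma = 1 / L]
    leaves half of the linear gain. *)
Lemma sketch_descent tau (S : 'M[R]_(m, tau)) (f : 'cV[R]_m) (gamma L : R) :
  0 < L -> gamma = 1 / L ->
  let B := mpinv (S^T *m J^T *m invmx W *m J *m S) in
  let y := - (gamma *: (invmx W *m J *m S *m B *m S^T *m f)) in
  dotv (J *m mpinv A *m f) y + L / 2 * sqnorm W y =
  - (gamma / 2) * sqnorm (S *m B *m S^T) f.
Proof.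
move=> L0 gL B y.
have [A' A'E] : exists A', A' = A by exists A.
have pA := metric_pd; rewrite -A'E in pA.
have uW := sym_pd_unit pW; have uA := sym_pd_unit pA.
have [q qE] : exists q, q = B *m (S^T *m f) by eexists.
have BE : B = mpinv (S^T *m A' *m S) by rewrite /B A'E /A !mulmxA.
have [_ BAB _ _] := mpinvP (S^T *m A' *m S); rewrite -BE in BAB.
have sB : B^T = B.
  by rewrite BE; apply: mpinv_sym; exact: (sym_psd_conj S (sym_pd_psd pA)).1.
have yE : y = - gamma *: (invmx W *m (J *m (S *m q))).
  by rewrite /y qE scaleNr !mulmxA.
clearbody B y.
have sE : sqnorm (S *m B *m S^T) f = dotv q (S^T *m f).
  by rewrite /sqnorm qE -!mulmxA dotv_mulmxl.
(* Here [B S^T A' S B = B] collapses the quadratic form in [q]. *)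
have qAq : dotv (S *m q) (A' *m (S *m q)) = dotv q (S^T *m f).
  rewrite dotv_mulmxl {1}qE dotv_mulmxl sB dotvC; congr dotv.
  by rewrite [in RHS]qE -[in RHS]BAB qE !mulmxA.
have JVJ : J^T *m (invmx W *m (J *m (S *m q))) = A' *m (S *m q).
  by rewrite A'E /A -!mulmxA.
rewrite sE yE dotvZr -A'E mpinv_unit// /sqnorm.
have -> : dotv (J *m invmx A' *m f) (invmx W *m (J *m (S *m q))) = dotv q (S^T *m f).
  rewrite -!mulmxA dotv_mulmxl JVJ dotv_mulmxl trmx_inv pA.1 mulKmx//.
  by rewrite dotvC dotv_mulmxl.
rewrite -scalemxAr mulKVmx// dotvZr dotvZl.
have -> : dotv (J *m (S *m q)) (invmx W *m (J *m (S *m q))) = dotv q (S^T *m f).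
  by rewrite dotv_mulmxl JVJ qAq.
by rewrite gL; field; rewrite gt_eqF.
Qed.

Lemma metric_sqnorm_le (H : 'M[R]_m) (f : 'cV[R]_m) : sym_psd H -> H \in unitmx ->
  lambda_min_pos (invmx (sqrtmx W) *m J *m H *m (invmx (sqrtmx W) *m J)^T)
    * sqnorm (mpinv A) f <= sqnorm H f.
Proof.
move=> pH uH; set M := invmx (sqrtmx W) *m J.
have [psR RR] := sqrtmxP (sym_pd_psd pW).
have [A' A'E] : exists A', A' = A by exists A.
have pA := metric_pd; rewrite -A'E in pA *.
have uW := sym_pd_unit pW; have uA := sym_pd_unit pA.
have uR : sqrtmx W \in unitmx.
  by move: uW; rewrite -[in X in X -> _]RR unitmx_mul => /andP[].
have MM : M^T *m M = A'.
  have VV : invmx (sqrtmx W) *m invmx (sqrtmx W) = invmx W.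
    apply: (can_inj (mulKmx uW)); rewrite mulmxV// -[X in X *m _ = _]RR.
    by rewrite -mulmxA mulKVmx// mulmxV.
  by rewrite /M trmx_mul trmx_inv psR.1 A'E /A -VV !mulmxA.
have mpE : mpinv A' = invmx A' by exact: mpinv_unit.
clearbody M.
have [K KE] : exists K, K = M *m H *m M^T by eexists.
have pK : sym_psd K by rewrite KE -{1}(trmxK M); exact: sym_psd_conj.
(* A preimage under [K] of [u = M A^-1 f], obtained from [M^T M = A'] and the invertibility of [H];
   it puts [u] in the range of [K], where the spectral bound applies. *)
pose w := M *m (invmx A' *m (invmx H *m (invmx A' *m f))).
have Kw : K *m w = M *m (invmx A' *m f).
  by rewrite KE /w -!mulmxA (mulmxA M^T) MM !mulKVmx.
have := lambda_min_pos_range w pK; rewrite Kw.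
have -> : sqnorm K (M *m (invmx A' *m f)) = sqnorm H f.
  by rewrite KE -{1}(trmxK M) sqnorm_conj (mulmxA M^T) MM mulKVmx.
rewrite -KE; congr (_ * _ <= _).
by rewrite dotv_mulmxl (mulmxA M^T) MM mulKVmx// mpE.
Qed.

End Descent.
End SketchAlgebra.

(** The product rule on the double sum of [Q a b * f b * f a] gives two sums, which the symmetry of
    [Q] identifies; the factor 1/2 absorbs the repetition. *)
Lemma grad_half_sqnorm (R : realType) p m (F : 'cV[R]_p -> 'cV[R]_m)
    (Q : 'M[R]_m) (x : 'cV[R]_p) :
  differentiable F x -> Q^T = Q ->
  grad (fun y => 2^-1 * sqnorm Q (F y)) x = nabla F x *m Q *m F x.
Proof.
move=> dF sQ; apply/colP => i; rewrite mxE.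
set v := delta_mx i 0 : 'cV[R]_p.
pose f b y := F y b 0 : R.
have df b : is_derive x v (f b) (nabla F x i b).
  have : derivable (f b) x v.
    by have /derivable_mxP := @diff_derivable _ _ _ _ _ v dF; exact.
  by move=> /derivableP; rewrite !mxE.
rewrite (_ : (fun y => _) =
    2^-1 *: \sum_(a < m) ((\sum_(b < m) Q a b *: f b) * f a) :> (_ -> R)); last first.
  apply/funext => y; rewrite !fctE fct_sumE /sqnorm dotvE; congr (_ * _).
  apply: eq_bigr => a _; rewrite fctE fct_sumE mxE; congr (_ * _).
rewrite derive_val.
set s1 := \sum_a \sum_b Q a b * nabla F x i a * f b x.
have fsum a : (\sum_(b < m) Q a b *: f b) x = \sum_b Q a b * f b x.
  by rewrite fct_sumE.
rewrite [X in 2^-1 *: X](_ : _ = s1 + s1); last first.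
  rewrite big_split/=; congr (_ + _).
    apply: eq_bigr => a _; rewrite fsum /GRing.scale/= mulr_suml.
    by apply: eq_bigr => b _; ring.
  rewrite /s1 exchange_big/=; apply: eq_bigr => a _.
  rewrite /GRing.scale/= mulr_sumr; apply: eq_bigr => b _.
  by rewrite -[in LHS]sQ mxE; ring.
have -> : 2^-1 *: (s1 + s1 : R^o) = s1 by rewrite /GRing.scale/=; field.
rewrite mxE /s1 exchange_big/=; apply: eq_bigr => b _.
rewrite mxE mulr_suml; apply: eq_bigr => a _.
by rewrite /f; ring.
Qed.

(** * The averaged sketch matrix *)

Section SketchMean.
Context {R : realType} (m tau r : nat) (pi : 'I_r -> R)
  (S : 'I_r -> 'M[R]_(m, tau)) (A : 'I_r -> 'M[R]_m).
Hypotheses (pi_gt0 : forall i, 0 < pi i) (pA : forall i, sym_pd (A i)).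
Let H := \sum_i pi i *: (S i *m mpinv ((S i)^T *m A i *m S i) *m (S i)^T).

Lemma sqnorm_sum n (I : finType) (c : I -> R) (B : I -> 'M[R]_n) v :
  sqnorm (\sum_i c i *: B i) v = \sum_i c i * sqnorm (B i) v.
Proof.
rewrite /sqnorm mulmx_suml dotvC /dotv mulmx_sumr summxE.
apply: eq_bigr => i _; rewrite -scalemxAl -scalemxAr mxE.
by congr (_ * _); rewrite -/(dotv v (B i *m v)) dotvC.
Qed.

Lemma sketch_psd i : sym_psd (S i *m mpinv ((S i)^T *m A i *m S i) *m (S i)^T).
Proof.
have pB : sym_psd (mpinv ((S i)^T *m A i *m S i)).
  by apply: mpinv_psd; apply: sym_psd_conj; exact: sym_pd_psd.
by have := sym_psd_conj (S i)^T pB; rewrite trmxK.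
Qed.

Lemma sketch_mean_psd : sym_psd H.
Proof.
split=> [|v].
  rewrite /H linear_sum/=; apply: eq_bigr => i _.
  by rewrite [LHS]linearZ/= (sketch_psd i).1.
rewrite /H sqnorm_sum; apply: sumr_ge0 => i _.
by apply: mulr_ge0; [exact: ltW|exact: (sketch_psd i).2].
Qed.

(** If [H] kills [v], the nonnegative terms of its quadratic form at [v] all vanish, the weights
    being positive. Each [S i *m (S i)^T] then kills [v], and so does their mean. *)
Lemma sketch_mean_unit :
  \sum_i pi i *: (S i *m (S i)^T) \in unitmx -> H \in unitmx.
Proof.
move=> uS; apply: inj_unitmx => v Hv.
have : sqnorm H v = 0 by rewrite /sqnorm Hv dotvE big1// => i _; rewrite mxE mul0r.
rewrite /H sqnorm_sum => /eqP; rewrite psumr_eq0 => [/allP Hv0|i _]; last first.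
  by apply: mulr_ge0; [exact: ltW|exact: (sketch_psd i).2].
suff SSv : (\sum_i pi i *: (S i *m (S i)^T)) *m v = 0.
  by rewrite -[v](mulKmx uS) SSv mulmx0.
rewrite mulmx_suml big1// => i _.
have := Hv0 i (mem_index_enum i); rewrite mulf_eq0 gt_eqF//= => /eqP.
by move=> /(sketch_ker (pA i)) SSv; rewrite -scalemxAl SSv scaler0.
Qed.

End SketchMean.

(** * Integrals of functions that are a.e. simple *)

Section AlmostIntegral.
Local Open Scope ereal_scope.
Context {d} {T : measurableType d} {R : realType} (P : probability T R).
Import HBNNSimple.
Implicit Types (A B : set T) (g : T -> R).

(* The integral of an arbitrary nonnegative function is the supremum of the
   integrals of the simple functions below it, so a null set can be discarded
   although [f] is only measurable outside it. *)
Lemma ge0_integral_conull B (f : T -> \bar R) :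
  measurable B -> P (~` B) = 0 -> measurable_fun B f -> (forall x, 0 <= f x) ->
  \int[P]_x f x = \int[P]_(x in B) f x.
Proof.
move=> mB PB mf f0; apply/eqP; rewrite eq_le; apply/andP; split; last first.
  rewrite integral_mkcond ge0_integralTE// ?ge0_integralTE//; last first.
    by move=> x; rewrite patchE; case: ifP.
  apply: le_ereal_sup => _ [h /= hf <-]; exists h => //= x.
  by apply: le_trans (hf x) _; rewrite patchE; case: ifP.
rewrite ge0_integralTE//; apply: ge_ereal_sup => _ [h /= hf <-].
have mh : measurable_fun setT (EFin \o h) by apply/measurable_EFinP.
have h0 x : 0 <= (EFin \o h) x by rewrite lee_fin.
rewrite -integralT_nnsfun.
(* The null complement of [B] is removed from the integral of the simple function [h], which is
   measurable everywhere; on [B], [h] is below [f]. *)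
rewrite (@ge0_negligible_integral _ _ _ P setT (~` B))//; first last.
- by move=> x _; exact: h0.
- exact: measurableC.
rewrite setTD setCK; apply: ge0_le_integral => //.
- by move=> x _; exact: h0.
- exact: measurable_funTS.
Qed.

Lemma integral_conull B g : measurable B -> P (~` B) = 0 -> measurable_fun B g ->
  \int[P]_x (g x)%:E = \int[P]_(x in B) (g x)%:E.
Proof.
move=> mB PB /measurable_EFinP mg; rewrite integralE [RHS]integralE.
congr (_ - _); apply: ge0_integral_conull => //.
- exact: measurable_funepos.
- exact: measurable_funeneg.
Qed.

(* [g] is unconstrained, possibly not measurable, on the null set [A `\` B]. *)
Definition has_ae_integral A g (v : R) := exists B,
  [/\ measurable B, B `<=` A, P B = P A, measurable_fun B g &
      \int[P]_(x in B) (g x)%:E = v%:E].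

Lemma has_ae_integralT g v : has_ae_integral setT g v -> \int[P]_x (g x)%:E = v%:E.
Proof.
move=> [B [mB _ PB mg <-]]; apply: integral_conull => //.
by rewrite probability_setC// PB probability_setT subee.
Qed.

Lemma has_ae_integral_cst A g c : measurable A -> (forall x, A x -> g x = c) ->
  has_ae_integral A g (c * fine (P A)).
Proof.
move=> mA gc; exists A; split => //.
  by apply: (eq_measurable_fun (cst c)) => // x /set_mem/gc.
rewrite (eq_integral (cst c%:E)) => [|x /set_mem/gc ->//].
by rewrite integral_cst// EFinM fineK// fin_num_measure.
Qed.

(** The conull measurable parts of the pieces are glued together. Equality of total mass replaces a
    covering of [A], so a null remainder may be left over. *)
Lemma has_ae_integral_split r A (E : 'I_r -> set T) g v : measurable A ->
  (forall i, measurable (E i)) -> (forall i, E i `<=` A) -> trivIset setT E ->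
  \sum_i P (E i) = P A -> (forall i, has_ae_integral (E i) g (v i)) ->
  has_ae_integral A g (\sum_i v i)%R.
Proof.
move=> mA mE EA tE PE /choice[B hB].
have mB i : measurable (B i) by have [] := hB i.
have BE i : B i `<=` E i by have [] := hB i.
have tB : trivIset setT B 
  by move=> i j _ _ [x [/BE Ex /BE Ey]]; apply: tE => //; exists x.
have mBg : measurable_fun (\big[setU/set0]_(i < r) B i) g.
  suff [] : measurable (\big[setU/set0]_(i < r) B i) /\
      measurable_fun (\big[setU/set0]_(i < r) B i) g by [].
  elim/big_rec: _ => [|i D _ [mD mgD]].
    by split => //; exact: measurable_fun_set0.
  split; first exact: measurableU.
  by apply/measurable_funU => //; split=> //; have [] := hB i.
exists (\big[setU/set0]_(i < r) B i); split.
- exact: bigsetU_measurable.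
- elim/big_ind: _ => [//|C D CA DA|i _]; first by rewrite subUset.
  exact: subset_trans (EA i).
- by rewrite measure_bigsetU_ord// -PE; apply: eq_bigr => i _; have [] := hB i.
- exact: mBg.
rewrite integral_bigsetU_EFin//=; first last.
- apply/measurable_EFinP; exact: mBg.
- exact: sub_trivIset tB.
- exact: index_enum_uniq.
by rewrite -sumEFin; apply: eq_bigr => i _; have [] := hB i.
Qed.

End AlmostIntegral.

Lemma measurable_mxpair_set1 (R : realType) m tau p (c : mxpair R m tau p) :
  measurable [set c].
Proof.
rewrite -[X in measurable X]setCK; apply: measurableC; apply: sub_sigma_algebra.
apply: closed_openC; apply: accessible_closed_set1.
by apply: hausdorff_accessible; exact: norm_hausdorff.
Qed.

(** [X] is arbitrary: the atoms carry the whole mass because the weights sum to 1, and injectivity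
    of [c] keeps the singletons disjoint. *)
Lemma Emx_atoms (R : realType) m tau p (D : probability (mxpair R m tau p) R)
    r (c : 'I_r -> mxpair R m tau p) (pi : 'I_r -> R) k l
    (X : mxpair R m tau p -> 'M[R]_(k, l)) :
  injective c -> (forall i, D [set c i] = (pi i)%:E) -> \sum_i pi i = 1 ->
  Emx D X = \sum_i pi i *: X (c i).
Proof.
move=> cI cD pi1; apply/matrixP => i j; rewrite mxE summxE /Rintegral.
rewrite (@has_ae_integralT _ _ _ D (fun t => X t i j) (\sum_s X (c s) i j * pi s))/=.
  by apply: eq_bigr => s _; rewrite mxE mulrC.
apply: (@has_ae_integral_split _ _ _ _ _ _ (fun s => [set c s])) => // [s|s s' _ _||s].
- exact: measurable_mxpair_set1.
- by move=> [_ [-> /cI]].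
- by rewrite probability_setT -pi1 -sumEFin; apply: eq_bigr => s _.
- rewrite -[pi s]/(fine (pi s)%:E) -cD.
  by apply: has_ae_integral_cst => [|_ -> //]; exact: measurable_mxpair_set1.
Qed.

(** * The run as a tree of draws *)

Section Run.
Context {R : realType} {p m tau : nat} {F : 'cV[R]_p -> 'cV[R]_m}
  {D : 'cV[R]_p -> probability (mxpair R m tau p) R}
  {r : 'cV[R]_p -> nat} (pi : forall x, 'I_(r x) -> R)
  {Si : forall x, 'I_(r x) -> 'M[R]_(m, tau)}
  {Wi : forall x, 'I_(r x) -> 'M[R]_p}
  {d : measure_display} {Omega : measurableType d} {P : probability Omega R}
  {gamma : R} {x0 : 'cV[R]_p} {x : nat -> Omega -> 'cV[R]_p}
  {SW : nat -> Omega -> mxpair R m tau p}.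
Arguments pi : clear implicits.
Arguments Si : clear implicits.
Arguments Wi : clear implicits.
Hypothesis hpi_gt0 : forall x i, 0 < pi x i.
Hypothesis hpi_sum : forall x, \sum_i pi x i = 1.
Hypothesis hSWi_inj : forall x, injective (fun i => (Si x i, Wi x i)).
Hypothesis hD : forall x i, D x [set (Si x i, Wi x i)] = (pi x i)%:E.
Hypothesis hnabla : forall x, (nabla F x)^T *m nabla F x \in unitmx.
Hypothesis hW : forall x i, sym_pd (Wi x i).
Hypothesis hrun : snrvm F D P gamma x0 x SW.

Let atom y i : mxpair R m tau p := (Si y i, Wi y i).
Arguments atom : clear implicits.
Let next y (a : mxpair R m tau p) := snrvm_next F gamma y a.1 a.2.
Let phi y (a : mxpair R m tau p) : R := fhat F y a.2 y.

(* The expectation of [fhat_n(x^n)] for a run started at [y]. *)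
Fixpoint mean_fhat n y : R := \sum_i pi y i *
  (if n is n'.+1 then mean_fhat n' (next y (atom y i)) else phi y (atom y i)).

Lemma past_measurable k A : past SW k A -> measurable A.
Proof.
move=> pA; have : <<s @measurable _ Omega >> A.
  apply: sub_sigma_algebra2 pA => _ [j _ [B mB <-]].
  by apply: (snrvm_measurable hrun).
by rewrite sigma_algebra_id//; exact: sigma_algebra_measurable.
Qed.

Lemma pastT k : past SW k setT.
Proof.
exact: (@measurableT _ (g_sigma_algebraType (\bigcup_(j in [set j | (j < k)%N])
  preimage_set_system setT (SW j) measurable))).
Qed.

Lemma past_draw k A y i : past SW k A ->
  past SW k.+1 (A `&` SW k @^-1` [set atom y i]).
Proof.
move=> pA; set G := \bigcup_(j in [set j | (j < k.+1)%N])
  preimage_set_system setT (SW j) measurable.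
apply: (@measurableI _ (g_sigma_algebraType G)).
  by apply: sub_sigma_algebra2 pA; apply: bigcup_subset => j /= /ltnW.
apply: sub_sigma_algebra; exists k => //=.
exists [set atom y i]; first exact: measurable_mxpair_set1.
by rewrite setTI.
Qed.

(** [D (x k w)] is [D y] throughout [A], so the conditional law integrates a constant over [A]. *)
Lemma prob_draw k A y i : past SW k A -> (forall w, A w -> x k w = y) ->
  P (A `&` SW k @^-1` [set atom y i]) = ((pi y i)%:E * P A)%E.
Proof.
move=> pA xA; rewrite (snrvm_law hrun)//; last exact: measurable_mxpair_set1.
rewrite (eq_integral (cst (pi y i)%:E)) => [|w /set_mem/xA ->]; last exact: hD.
by rewrite integral_cst//; exact: past_measurable pA.
Qed.

Lemma run_draw k A y i w : (forall w, A w -> x k w = y) ->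
  (A `&` SW k @^-1` [set atom y i]) w -> x k.+1 w = next y (atom y i).
Proof. by move=> xA [/xA xk /= Sk]; rewrite (snrvm_step hrun) xk Sk. Qed.

(** One branching of the tree: up to a null set, the atom drawn at iteration [k] splits [A] into
    disjoint events whose masses are proportional to the weights. *)
Lemma has_ae_integral_draw k A y g v : past SW k A -> (forall w, A w -> x k w = y) ->
  (forall i, has_ae_integral P (A `&` SW k @^-1` [set atom y i]) g
     (v i * fine (P (A `&` SW k @^-1` [set atom y i])))) ->
  has_ae_integral P A g ((\sum_i pi y i * v i) * fine (P A)).
Proof.
move=> pA xA gv; have mA := past_measurable pA.
rewrite mulr_suml.
apply: (has_ae_integral_split (E := fun i => A `&` SW k @^-1` [set atom y i])) => //.
- by move=> i; exact: past_measurable (past_draw i pA).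
- by move=> i j _ _ [w [[_ /= Si_w] [_ /=]]]; rewrite Si_w => /hSWi_inj.
- under eq_bigr do rewrite (prob_draw _ pA)//.
  rewrite -ge0_sume_distrl => [|i _]; last by rewrite lee_fin ltW.
  by rewrite sumEFin hpi_sum mul1e.
- move=> i; rewrite (_ : _ * fine (P A)
      = v i * fine (P (A `&` SW k @^-1` [set atom y i])))//.
  by rewrite (prob_draw _ pA)// fineM ?fin_num_measure//= [pi y i * v i]mulrC mulrA.
Qed.

(** [A] is a node of the tree, a past event on which the iterate is constant, and [n] counts the
    iterations still to go. The induction keeps [k], [A] and [y] free because each draw passes to a
    child node. *)
Lemma run_expectation n k A y : past SW k A -> (forall w, A w -> x k w = y) ->
  has_ae_integral P A (fun w => phi (x (n + k) w) (SW (n + k) w))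
    (mean_fhat n y * fine (P A)).
Proof.
elim: n k A y => [|n IHn] k A y pA xA;
  apply: (has_ae_integral_draw pA xA) => i.
  apply: has_ae_integral_cst; first exact: past_measurable (past_draw i pA).
  by move=> w [/xA xk /= Sk]; rewrite add0n xk Sk.
have := IHn _ _ _ (past_draw i pA) (fun w => run_draw xA (w := w)).
by rewrite addnS.
Qed.

Lemma phi_atom_ge0 y i : 0 <= phi y (atom y i).
Proof.
apply: mulr_ge0; first by rewrite invr_ge0.
apply: (mpinv_psd _).2; apply: sym_pd_psd.
by apply: metric_pd; [exact: hnabla|exact: hW].
Qed.

Lemma mean_fhat_ge0 n y : 0 <= mean_fhat n y.
Proof.
elim: n y => [|n IHn] y /=; apply: sumr_ge0 => i _; apply: mulr_ge0 => //.
- exact: ltW.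
- exact: phi_atom_ge0.
- exact: ltW.
Qed.

(** The smoothness and eigenvalue assumptions hold only along the run. An event of positive mass
    supplies a realization passing through [y], even outside a prescribed null set. *)
Definition reachable y := exists k A,
  [/\ past SW k A, (0 < P A)%E & forall w, A w -> x k w = y].

Lemma reachable_init : reachable x0.
Proof.
exists 0%N, setT; split; last by move=> w _; exact: snrvm_init hrun w.
  exact: pastT.
by rewrite probability_setT.
Qed.

Lemma reachable_next y i : reachable y -> reachable (next y (atom y i)).
Proof.
move=> [k [A [pA PA xA]]].
exists k.+1, (A `&` SW k @^-1` [set atom y i]); split.
- exact: past_draw.
- by rewrite (prob_draw _ pA)// mule_gt0// lte_fin.
- by move=> w; exact: run_draw.
Qed.

(** * Decrease of the mean at reachable points, and its iteration *)

Hypothesis hF : C1 F.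
Hypothesis hSS : forall x, Emx (D x) (fun sw => sw.1 *m sw.1^T) \in unitmx.
Variable L : R.
Hypothesis hL : 0 < L.
Hypothesis hsmooth : forall (w : Omega) (k : nat) (y : 'cV[R]_p),
     let W j := (SW j w).2 in
     fhat F (x k.+1 w) (W k.+1) y
       <= fhat F (x k w) (W k) (x k w)
          + dotv (grad (fhat F (x k w) (W k)) (x k w)) (y - x k w)
          + L / 2 * sqnorm (W k) (y - x k w).
Hypothesis hgammaL : gamma = 1 / L.
Variable rho : R.
Hypothesis hrho_inf : {ae P, forall w,
     rho <= inf (range (fun k => rho_at F D (x k w) (Wi (x k w))))}.

Let sketch y i := Si y i *m sketched_pinv F y (Si y i) (Wi y i) *m (Si y i)^T.
Arguments sketch : clear implicits.

Lemma positive_nonempty (A : set Omega) : (0 < P A)%E -> exists w, A w.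
Proof.
move=> PA; apply: contrapT => A0; move: PA.
rewrite (_ : A = set0) ?measure0 ?ltxx//.
by apply/seteqP; split => // w Aw; apply: A0; exists w.
Qed.

(** Assumption (3) at the point [x k.+1 w], for a realization that draws atom [i] at iteration [k]
    and atom [j] at the next one. Its right-hand side does not involve [j]. *)
Lemma phi_next_le y i j : reachable y ->
  phi (next y (atom y i)) (atom (next y (atom y i)) j)
    <= phi y (atom y i) - gamma / 2 * sqnorm (sketch y i) (F y).
Proof.
move=> [k [A [pA PA xA]]]; set z := next y (atom y i).
have pAi := past_draw i pA.
have xAi w : (A `&` SW k @^-1` [set atom y i]) w -> x k.+1 w = z by exact: run_draw.
(* Such a realization exists because two successive draws multiply the positive mass of [A] by two
   positive weights. *)
have [w [Aiw Sk1]] : exists w,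
    ((A `&` SW k @^-1` [set atom y i]) `&` SW k.+1 @^-1` [set atom z j]) w.
  apply: positive_nonempty; rewrite prob_draw// mule_gt0 ?lte_fin//.
  by rewrite prob_draw// mule_gt0 ?lte_fin.
have xk := xA w Aiw.1; have Sk : SW k w = atom y i := Aiw.2.
have := hsmooth w k z; rewrite /= xk (xAi w Aiw) Sk (Sk1 : _ = _) /=.
move=> /le_trans; apply; rewrite -addrA lerD2l.
set Q := mpinv ((nabla F y)^T *m invmx (Wi y i) *m nabla F y).
have pA' := metric_pd (hnabla y) (hW i).
rewrite (grad_half_sqnorm (hF.1 y) (mpinv_sym pA'.1)).
have -> : z - y = - (gamma *: (invmx (Wi y i) *m nabla F y *m Si y i
    *m sketched_pinv F y (Si y i) (Wi y i) *m (Si y i)^T *m F y)).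
  by rewrite /z /next /snrvm_next addrC addKr.
by rewrite (sketch_descent (hnabla y) (hW i))// mulNr.
Qed.

Lemma Hmx_atoms y : Hmx F D y = \sum_i pi y i *: sketch y i.
Proof. by rewrite /Hmx (Emx_atoms (c := atom y) _ _ (@hD y)). Qed.

Lemma Hmx_psd_unit y : sym_psd (Hmx F D y) /\ Hmx F D y \in unitmx.
Proof.
pose A i := (nabla F y)^T *m invmx (Wi y i) *m nabla F y.
have pA i : sym_pd (A i) by exact: metric_pd.
have -> : Hmx F D y = \sum_i pi y i *:
    (Si y i *m mpinv ((Si y i)^T *m A i *m Si y i) *m (Si y i)^T).
  rewrite Hmx_atoms; apply: eq_bigr => i _.
  by rewrite /sketch /sketched_pinv /A !mulmxA.
split; first exact: sketch_mean_psd.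
apply: sketch_mean_unit => //.
by have := hSS y; rewrite (Emx_atoms (c := atom y) _ _ (@hD y)).
Qed.

Lemma rho_le_lambda_min_pos y i : reachable y ->
  rho <= lambda_min_pos (invmx (sqrtmx (Wi y i)) *m nabla F y *m Hmx F D y
    *m (invmx (sqrtmx (Wi y i)) *m nabla F y)^T).
Proof.
move=> [k [A [pA PA xA]]]; have [N [mN PN rhoN]] := hrho_inf.
have [w [Aw Nw]] : exists w, (A `\` N) w.
  apply: contrapT => AN; have PA0 : P A = 0%E.
    apply: subset_measure0 PN => //; first exact: past_measurable pA.
    by move=> w Aw; apply: contrapT => Nw; apply: AN; exists w.
  by move: PA; rewrite PA0 ltxx.
have {rhoN Nw} : rho <= inf (range (fun k => rho_at F D (x k w) (Wi (x k w)))).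
  by apply: contrapT => /rhoN.
move=> /le_trans; apply.
(* An [inf] is below the members of a set only when that set is bounded below; 0 serves for both the
   infimum over atoms and the one over iterations. *)
have rho_ge0 z : lbound (range (fun i =>
    lambda_min_pos (invmx (sqrtmx (Wi z i)) *m nabla F z *m Hmx F D z
      *m (invmx (sqrtmx (Wi z i)) *m nabla F z)^T))) 0.
  by move=> _ [j _ <-]; exact: lambda_min_pos_ge0.
apply: (@le_trans _ _ (rho_at F D (x k w) (Wi (x k w)))).
  apply: ge_inf; last by exists k.
  by exists 0 => _ [l _ <-]; apply: inf_ge0; exact: rho_ge0.
by rewrite xA//; apply: ge_inf; [exists 0; exact: rho_ge0|exists i].
Qed.

Lemma mean_fhat1_le y : reachable y ->
  mean_fhat 1 y <= (1 - rho * gamma) * mean_fhat 0 y.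
Proof.
move=> ry; pose h := sqnorm (Hmx F D y) (F y).
have Hpi : h = \sum_i pi y i * sqnorm (sketch y i) (F y).
  by rewrite /h Hmx_atoms sqnorm_sum.
have step : mean_fhat 1 y <= mean_fhat 0 y - gamma / 2 * h.
  rewrite Hpi mulr_sumr -sumrB; apply: ler_sum => i _.
  rewrite [gamma / 2 * _]mulrCA -mulrBr; apply: ler_wpM2l; first exact: ltW.
  (* [q] is independent of the second draw, so it is spread over the weights at the next point and
     compared term by term. *)
  set q := phi y _ - _; rewrite -[q]mul1r -(hpi_sum (next y (atom y i))) mulr_suml.
  apply: ler_sum => j _; apply: ler_wpM2l; [exact: ltW|exact: phi_next_le].
have rate : rho * mean_fhat 0 y <= 2^-1 * h.
  (* The spectral bound holds for each [Wi y i] separately, with the same [H]; averaging it over the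
     weights gives the rate. *)
  have -> : 2^-1 * h = \sum_i pi y i * (2^-1 * h) by rewrite -mulr_suml hpi_sum mul1r.
  rewrite [mean_fhat 0 y]/= mulr_sumr; apply: ler_sum => i _.
  rewrite mulrCA; apply: ler_wpM2l; first exact: ltW.
  rewrite /phi /fhat mulrCA; apply: ler_wpM2l; first by rewrite invr_ge0.
  have [psdH uH] := Hmx_psd_unit y.
  apply: le_trans (metric_sqnorm_le (hnabla y) (hW i) (F y) psdH uH).
  rewrite ler_wpM2r//; last exact: rho_le_lambda_min_pos.
  apply: (mpinv_psd _).2; exact: sym_pd_psd (metric_pd (hnabla y) (hW i)).
have g0 : 0 <= gamma by rewrite hgammaL divr_ge0// ltW.
have grate := ler_wpM2l g0 rate.
suff lin (m0 m1 h' : R) : m1 <= m0 - gamma / 2 * h' ->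
    gamma * (rho * m0) <= gamma * (2^-1 * h') -> m1 <= (1 - rho * gamma) * m0.
  exact: lin step grate.
by move=> *; lra.
Qed.

(** The one-step bound is applied at the last level of the tree and averaged back to the root; every
    child of a reachable point is reachable. *)
Lemma mean_fhatS_le n y : reachable y ->
  mean_fhat n.+1 y <= (1 - rho * gamma) * mean_fhat n y.
Proof.
elim: n y => [|n IHn] y ry; first exact: mean_fhat1_le.
rewrite [mean_fhat n.+2 y]/= [mean_fhat n.+1 y]/= mulr_sumr; apply: ler_sum => i _.
by rewrite mulrCA ler_pM2l//; apply: IHn; exact: reachable_next.
Qed.

(* If [rho * gamma > 1], nonnegativity of the means forces all of them to vanish. *)
Lemma mean_fhat_geometric k :
  mean_fhat k x0 <= (1 - rho * gamma) ^+ k * mean_fhat 0 x0.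
Proof.
have decr n := mean_fhatS_le n reachable_init.
have [c0|c0] := leP 0 (1 - rho * gamma).
  elim: k => [|k IHk]; first by rewrite expr0 mul1r.
  by rewrite exprS -mulrA; apply: le_trans (decr k) _; exact: ler_wpM2l.
have zero n : mean_fhat n x0 = 0.
  apply/eqP; rewrite eq_le mean_fhat_ge0 andbT -(nmulr_rge0 _ c0).
  exact: le_trans (mean_fhat_ge0 _ _) (decr n).
by rewrite !zero mulr0.
Qed.

(** The root of the tree: the whole space is a past event at iteration 0, on which the iterate is
    the deterministic [x0]. *)
Lemma expectation_fhat k :
  ('E_P[fun w => fhat F (x k w) (SW k w).2 (x k w)] = (mean_fhat k x0)%:E)%E.
Proof.
rewrite unlock; apply: has_ae_integralT.
have := run_expectation k (k := 0%N) (A := setT) (y := x0).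
rewrite addn0 probability_setT mulr1; apply.
  exact: pastT.
by move=> w _; exact: snrvm_init hrun w.
Qed.

End Run.

Theorem theorem4p5 (R : realType) (p m tau : nat)
  (F : 'cV[R]_p -> 'cV[R]_m)
  (D : 'cV[R]_p -> probability (mxpair R m tau p) R)
  (hF : C1 F)
  (* (1) proper finite distribution *)
  (r : 'cV[R]_p -> nat)
  (pi : forall x : 'cV[R]_p, 'I_(r x) -> R)
  (Si : forall x : 'cV[R]_p, 'I_(r x) -> 'M[R]_(m, tau))
  (Wi : forall x : 'cV[R]_p, 'I_(r x) -> 'M[R]_p)
  (hpi_gt0 : forall x i, 0 < pi x i)
  (hpi_sum : forall x, \sum_i pi x i = 1)
  (hSWi_inj : forall x, injective (fun i => (Si x i, Wi x i)))
  (hD : forall x i, D x [set (Si x i, Wi x i)] = (pi x i)%:E)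
  (* (2) *)
  (hnabla : forall x, (nabla F x)^T *m nabla F x \in unitmx)
  (hSS : forall x, Emx (D x) (fun sw => sw.1 *m sw.1^T) \in unitmx)
  (hW : forall x i, sym_pd (Wi x i))
  (* the SNRVM run *)
  (d : measure_display) (Omega : measurableType d) (P : probability Omega R)
  (gamma : R) (hgamma : 0 < gamma)
  (x0 : 'cV[R]_p)
  (x : nat -> Omega -> 'cV[R]_p)
  (SW : nat -> Omega -> mxpair R m tau p)
  (hrun : snrvm F D P gamma x0 x SW)
  (* (3), for every realization w *)
  (L : R) (hL : 0 < L)
  (hsmooth : forall (w : Omega) (k : nat) (y : 'cV[R]_p),
     let W j := (SW j w).2 in
     fhat F (x k.+1 w) (W k.+1) y
       <= fhat F (x k w) (W k) (x k w)
          + dotv (grad (fhat F (x k w) (W k)) (x k w)) (y - x k w)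
          + L / 2 * sqnorm (W k) (y - x k w))
  (hgammaL : gamma = 1 / L)
  (rho : R) (hrho : 0 < rho)
  (hrho_inf : {ae P, forall w,
     rho <= inf (range (fun k => rho_at F D (x k w) (Wi (x k w))))})
  (k : nat) :
  ('E_P[fun w => fhat F (x k w) (SW k w).2 (x k w)]
     <= ((1 - rho * gamma) ^+ k)%:E
        * 'E_P[fun w => fhat F (x 0%N w) (SW 0%N w).2 (x 0%N w)])%E.
Proof.
rewrite !(expectation_fhat hpi_gt0 hpi_sum hSWi_inj hD hrun) -EFinM lee_fin.
exact: (mean_fhat_geometric hpi_gt0 hpi_sum hSWi_inj hD hnabla hW hrun hF hSS
  hL hsmooth hgammaL hrho_inf).
Qed.
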